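(* Let $X_1,X_2,\dots$ be independent random variables with a common continuous distribution function $F$. For each $n\ge1$ let $\Pi(n)$ be the set of feasible policies for the sequential selection of a unimodal subsequence of $X_1,\dots,X_n$, and let $\pi^*_n\in\Pi(n)$ be the optimal policy, i.e. the policy attaining $\sup_{\pi_n\in\Pi(n)}\mathbb{E}[U^o_n(\pi_n)]$. Then $$\frac{U^o_n(\pi^*_n)}{\sqrt{n}} \longrightarrow 2 \quad \text{in probability as } n \rightarrow \infty.$$
   Context: Let $\mathcal{F}_i=\sigma\{X_1,\dots,X_i\}$, $1\le i\le n$. The variables $X_1,\dots,X_n$ are presented one at a time; when $X_i$ is presented at time $i$ the chooser must irrevocably accept or reject it, using only $X_1,\dots,X_i$. A policy thus yields indices $1\le \tau_1<\tau_2<\cdots<\tau_k\le n$ of selected elements, each $\tau_j$ being a stopping time with respect to $(\mathcal{F}_i)$. A policy is feasible (belongs to $\Pi(n)$) if the selected values are always unimodal, meaning that for some $1\le t\le k$ $$X_{\tau_1}\le\cdots\le X_{\tau_t}\ge X_{\tau_{t+1}}\ge\cdots\ge X_{\tau_k}$$ (increasing piece first, then decreasing piece; either piece may have size one). $U^o_n(\pi_n)$ is the number $k$ of elements selected by $\pi_n$. An optimal policy exists and is unique in the sense that any two optimal policies almost surely select the same elements. *)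

(* Defs.v *)
From mathcomp Require Import all_boot all_order all_algebra finmap.
From mathcomp Require Import all_classical all_reals all_analysis.

Set Implicit Arguments.
Unset Strict Implicit.
Unset Printing Implicit Defensive.

Import Order.TTheory GRing.Theory Num.Theory.
Import numFieldNormedType.Exports.

Local Open Scope classical_set_scope.
Local Open Scope ring_scope.

(* Time indices start at 0: the observation
   X_(i+1) of the literature is [X i], and a horizon of length n presents
   [X 0], ..., [X n.-1]. *)

(* Product rule over every finite subfamily. *)
Definition mutually_independent (R : realType) (d : measure_display)
    (T : measurableType d) (P : probability T R) (X : nat -> {RV P >-> R}) :
    Prop :=
  forall (J : {fset nat}) (B : nat -> set R),
    (forall j, j \in J -> measurable (B j)) ->
    P (\bigcap_(j in [set` J]) (X j @^-1` B j))
    = (\prod_(j <- J) P (X j @^-1` B j))%E.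

Definition natural_filtration (R : realType) (d : measure_display)
    (T : measurableType d) (P : probability T R) (X : nat -> {RV P >-> R})
    (i : nat) : set (set T) :=
  <<s \bigcup_(j in [set j | (j <= i)%N])
        preimage_set_system setT (X j) measurable >>.

(* [a i w] is true iff the observation presented at time i is accepted. *)
Definition policy (T : Type) (n : nat) : Type := 'I_n -> T -> bool.

(* The j-th entry of this increasing list is the selection time tau_(j+1). *)
Definition selected (T : Type) (n : nat) (a : policy T n) (w : T) : seq 'I_n :=
  [seq i <- enum 'I_n | a i w].

Definition num_selected (T : Type) (n : nat) (a : policy T n) (w : T) : nat :=
  size (selected a w).

(* t is the 0-based position of the peak; in particular s is nonempty. *)
Definition unimodal (R : realType) (s : seq R) : Prop :=
  exists t : nat,
    [/\ (t < size s)%N,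
        forall j : nat, (j < t)%N -> s`_j <= s`_j.+1 &
        forall j : nat, (t <= j)%N -> (j.+1 < size s)%N -> s`_j.+1 <= s`_j].

(* Since each acceptance event at time i lies in the i-th sigma-algebra, the
   successive selection times are stopping times. *)
Definition feasible (R : realType) (d : measure_display)
    (T : measurableType d) (P : probability T R) (X : nat -> {RV P >-> R})
    (n : nat) (a : policy T n) : Prop :=
  (forall i : 'I_n, natural_filtration X i [set w | a i w]) /\
  (forall w : T, unimodal [seq X i w | i : 'I_n <- selected a w]).

Definition expected_selected (R : realType) (d : measure_display)
    (T : measurableType d) (P : probability T R) (n : nat) (a : policy T n) :
    \bar R :=
  'E_P[fun w => (num_selected a w)%:R]%E.

Definition optimal (R : realType) (d : measure_display)
    (T : measurableType d) (P : probability T R) (X : nat -> {RV P >-> R})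
    (n : nat) (a : policy T n) : Prop :=
  feasible X a /\
  expected_selected P a
  = ereal_sup [set expected_selected P b | b in [set b | @feasible R d T P X n b]].

Definition cvg_in_probability (R : realType) (d : measure_display)
    (T : measurableType d) (P : probability T R) (Y : nat -> T -> R) (c : R) :
    Prop :=
  forall eps : R, 0 < eps ->
    P [set w | eps < `|Y n w - c|] @[n --> \oo] --> 0%E.

(* Main.v *)
(* Replace each value by the index of its cell among m cells of equal
   probability, delimited by quantiles of F; this map is monotone and the cells
   are i.i.d. uniform.

   Upper bound.  A unimodal selection climbs through the positions 0..2M
   (M = m - 1), cell u being at u while the selection rises and at 2M - u while
   it falls.  If each accepted observation has cost c, the distance travelled,
   then 1 <= c/L + (1 - c/L)_+ for every L > 0, so the number U of accepted
   observations is at most 2M/L + S, where S sums (1 - c/L)_+ over all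
   observations.  Given the past, distinct cells have distinct costs, so each
   summand has conditional mean at most (L+1)/(2m).  With L/m ~ 2/sqrt n this
   yields E U^2 <= 4n + O(sqrt n) for every feasible policy.

   Lower bound.  On the first half of the horizon accept the cells lying at most
   L above the last accepted one, on the second half do the same downwards.  Up
   to the exhaustion of the cells each half is a random walk with i.i.d.
   increments, and Chebyshev's inequality gives E U >= (2 - o(1)) sqrt n, a
   bound inherited by the optimal policy.

   Hence E (U/sqrt n - 2)^2 = E U^2/n - 4 E U/sqrt n + 4 tends to 0. *)
Require Import Defs.
From mathcomp Require Import all_boot all_order all_algebra finmap.
From mathcomp Require Import all_classical all_reals all_analysis.
From mathcomp Require Import zify ring lra.
Import Order.TTheory GRing.Theory Num.Theory.
Import numFieldNormedType.Exports.
Local Open Scope classical_set_scope.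
Local Open Scope ring_scope.

Set Implicit Arguments.
Unset Strict Implicit.
Unset Printing Implicit Defensive.

(** * Random variables with finitely many values *)

(* [K] is regarded as a discrete space: every preimage must be measurable. *)
Definition simple d (T : measurableType d) (K : Type) (Y : T -> K) : Prop :=
  finite_set (range Y) /\ forall B : set K, measurable (Y @^-1` B).

Section SimpleFunctions.
Context d (T : measurableType d).

Lemma simple_comp (K L : Type) (f : K -> L) (Y : T -> K) :
  simple Y -> simple (f \o Y).
Proof.
move=> [finY mY]; split; last by move=> B; exact: (mY (f @^-1` B)).
by rewrite -(image_comp Y f); exact: finite_image.
Qed.

Lemma simple_cst (K : Type) (k : K) : simple (fun _ : T => k).
Proof.
split; first exact: finite_image_cst.
by move=> B; rewrite preimage_cst; case: ifP.
Qed.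

Lemma simple_pair (K L : Type) (Y : T -> K) (Z : T -> L) :
  simple Y -> simple Z -> simple (fun w => (Y w, Z w)).
Proof.
move=> [finY mY] [finZ mZ]; split.
  apply: sub_finite_set (finite_setX finY finZ) => _ [w _ <-] /=.
  by split; exists w.
move=> B.
rewrite [X in measurable X](_ : _ = \bigcup_(y in range Y)
    (Y @^-1` [set y] `&` Z @^-1` [set z | B (y, z)])).
  by apply: fin_bigcup_measurable => // y _; exact: measurableI.
apply/seteqP; split=> [w Bw|w [_ [v _ <-]] [/= -> //]].
by exists (Y w) => //; exists w.
Qed.

Lemma simple_comp2 (K L M : Type) (f : K -> L -> M) (Y : T -> K) (Z : T -> L) :
  simple Y -> simple Z -> simple (fun w => f (Y w) (Z w)).
Proof.
move=> sY sZ.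
exact: (simple_comp (fun yz => f yz.1 yz.2) (simple_pair sY sZ)).
Qed.

Lemma simple_bool (b : T -> bool) : measurable [set w | b w] -> simple b.
Proof.
move=> mb; split; first exact: finite_finset.
move=> B.
rewrite [X in measurable X](_ : _ =
    ((if `[<B true>] then [set w | b w] else set0) `|`
     (if `[<B false>] then ~` [set w | b w] else set0))); last first.
  apply/seteqP; split=> w /=.
    by case bw: (b w) => Bb; [left|right]; rewrite asboolT//= bw.
  by case bw: (b w) => -[]; case: asboolP => //=; rewrite bw.
by apply: measurableU; case: ifP => // _; exact: measurableC.
Qed.

Lemma simple_sum (V : nmodType) (I : Type) (r : seq I) (Y : I -> T -> V) :
  (forall i, simple (Y i)) -> simple (fun w => \sum_(i <- r) Y i w).
Proof.
move=> sY; elim: r => [|i r IH].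
  by under eq_fun do rewrite big_nil; exact: simple_cst.
by under eq_fun do rewrite big_cons; exact: simple_comp2.
Qed.

End SimpleFunctions.

(** With [g := idfun] this passes from a sub-sigma-algebra to a larger one. *)
Lemma simple_sub d d' (T : measurableType d) (T' : measurableType d')
    (K : Type) (g : T -> T') (Y : T' -> K) :
    (forall A, measurable A -> measurable (g @^-1` A)) ->
  simple Y -> simple (Y \o g).
Proof.
move=> mg [finY mY]; split; last by move=> B; exact: (mg _ (mY B)).
by apply: sub_finite_set finY => _ [w _ <-]; exists (g w).
Qed.

(** * Expectations of finitely-valued variables *)

Section Expectation.
Context d (T : measurableType d) (R : realType) (P : probability T R).

Definition Ex (W : T -> R) : R := \int[P]_w W w.

Implicit Types (V W : T -> R).

Lemma simple_integrable W : simple W -> P.-integrable setT (EFin \o W).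
Proof.
move=> [finW mW]; apply: measurable_bounded_integrable => //.
- by apply: le_lt_trans (probability_le1 P measurableT) _; exact: ltry.
- by move=> _ B _; rewrite setTI; exact: mW.
- have [M HM] : exists M : R, forall y, range W y -> `|y| <= M.
    exists (\sum_(y <- fset_set (range W)) `|y|) => y Wy.
    have : y \in fset_set (range W) by rewrite in_fset_set// inE.
    move=> yW; rewrite (bigD1_seq y) ?fset_uniq //=. rewrite lerDl.
    by apply: sumr_ge0.
  exists M; split; first exact: num_real.
  move=> N MN w _; apply: le_trans (ltW MN).
  by apply: HM; exists w.
Qed.

Lemma ExE W : simple W -> 'E_P[W]%E = (Ex W)%:E.
Proof.
move=> sW; rewrite unlock /Ex /Rintegral fineK//.
by apply: integrable_fin_num => //; exact: simple_integrable.
Qed.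

Lemma ExD V W : simple V -> simple W -> Ex (fun w => V w + W w) = Ex V + Ex W.
Proof. by move=> sV sW; apply: RintegralD => //; exact: simple_integrable. Qed.

Lemma ExZ c W : simple W -> Ex (fun w => c * W w) = c * Ex W.
Proof. by move=> sW; apply: RintegralZl => //; exact: simple_integrable. Qed.

Lemma Ex_cst c : Ex (fun=> c) = c.
Proof.
rewrite /Ex Rintegral_cst// [X in fine X](_ : _ = 1%E) ?mulr1//.
exact: probability_setT.
Qed.

Lemma Ex_le V W : simple V -> simple W -> (forall w, V w <= W w) ->
  Ex V <= Ex W.
Proof.
by move=> sV sW VW; apply: le_Rintegral => //; exact: simple_integrable.
Qed.

Lemma Ex_sum (I : Type) (r : seq I) (W : I -> T -> R) :
  (forall i, simple (W i)) ->
  Ex (fun w => \sum_(i <- r) W i w) = \sum_(i <- r) Ex (W i).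
Proof.
move=> sW; elim: r => [|i r IH].
  by rewrite big_nil -[RHS]Ex_cst; congr Ex; apply/funext => w; rewrite big_nil.
rewrite big_cons -IH -ExD//; last exact: simple_sum.
by congr Ex; apply/funext => w; rewrite big_cons.
Qed.

Lemma simple_indic (A : set T) : measurable A -> simple (\1_A : T -> R).
Proof.
move=> mA.
have -> : (\1_A : T -> R) = (fun b : bool => b%:R) \o (fun w => w \in A).
  by apply/funext => w; rewrite indicE.
apply: simple_comp; apply: simple_bool.
rewrite [X in measurable X](_ : _ = A)//.
by apply/seteqP; split=> w /=; rewrite inE.
Qed.

Lemma Ex_indic (A : set T) : measurable A -> P A = (Ex \1_A)%:E.
Proof.
move=> mA; rewrite -ExE; last exact: simple_indic.
by rewrite unlock integral_indic// setIT.
Qed.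

(** [W] is a finite combination of indicators of its level sets, which lie in [<<s G >>]; linearity
    reduces the claim to the hypothesis on events. *)
Lemma Ex_indep (G : set (set T)) (E : set T) (p : R)
    (W : g_sigma_algebraType G -> R) :
    <<s G >> `<=` measurable -> measurable E ->
    (forall A, <<s G >> A -> P (A `&` E) = P A * p%:E)%E ->
  simple W -> Ex (fun w : T => W w * \1_E w) = Ex W * p.
Proof.
move=> Gm mE indep [finW mW].
have mWT (y : R) : measurable (W @^-1` [set y] : set T)
  by apply: Gm; exact: (mW [set y]).
have WE w : W w = \sum_(y <- fset_set (range W)) y * \1_(W @^-1` [set y]) w.
  rewrite (bigD1_seq (W w)) ?fset_uniq//=; last first.
    rewrite in_fset_set// inE. by exists w.
  rewrite indicE mem_set//= mulr1 big1 ?addr0// => y /negP yW.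
  by rewrite indicE memNset ?mulr0//= => Wy; apply: yW; rewrite Wy.
have -> : Ex W = \sum_(y <- fset_set (range W)) y * Ex \1_(W @^-1` [set y]).
  transitivity (Ex (fun w : T =>
      \sum_(y <- fset_set (range W)) y * \1_(W @^-1` [set y]) w)).
    by congr Ex; apply/funext => w; exact: WE.
  rewrite Ex_sum; last first.
    move=> y; apply: (simple_comp ( *%R y)); exact: simple_indic.
  by apply: eq_bigr => y _; rewrite ExZ//; exact: simple_indic.
rewrite mulr_suml.
transitivity (Ex (fun w : T => \sum_(y <- fset_set (range W))
    y * \1_((W @^-1` [set y]) `&` E) w)).
  congr Ex; apply/funext => w; rewrite {1}WE mulr_suml.
  by apply: eq_bigr => y _; rewrite indicI/= mulrA.
rewrite Ex_sum; last first.
  move=> y; apply: (simple_comp ( *%R y)); apply: simple_indic.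
  exact: measurableI.
apply: eq_bigr => y _; rewrite ExZ; last first.
  by apply: simple_indic; exact: measurableI.
rewrite -mulrA; congr (_ * _); apply: EFin_inj.
rewrite -Ex_indic; last exact: measurableI.
by rewrite indep ?EFinM -?Ex_indic//; exact: mW.
Qed.

End Expectation.

(** * Independence from the past and quantile cells *)

Section Independence.
Context (R : realType) d (T : measurableType d) (P : probability T R).
Variable X : nat -> {RV P >-> R}.
Hypothesis X_indep : mutually_independent X.

(** The past is strict: [past i.+1] unfolds to the generators of the natural filtration at time
    [i]. *)
Definition past (i : nat) : set (set T) :=
  \bigcup_(j in [set j | (j < i)%N]) preimage_set_system setT (X j) measurable.

Lemma past_measurable i : <<s past i >> `<=` measurable.
Proof.
apply: smallest_sub; first exact: sigma_algebra_measurable.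
by move=> A [j _ [B mB <-]]; exact: measurable_funP.
Qed.

Lemma past_mono i j : (i <= j)%N -> <<s past i >> `<=` <<s past j >>.
Proof.
move=> ij; apply: sub_smallest2r; first exact: smallest_sigma_algebra.
by move=> A [k /= ki Ak]; exists k => //=; exact: leq_trans ki ij.
Qed.

(** Dynkin's argument: boxes in the coordinates before [i] are stable under intersection and
    generate the past, and the events satisfying the product formula with a fixed event of [X i] are
    closed under complements and disjoint countable unions. *)
Lemma past_indep i (A : set T) (B : set R) : <<s past i >> A -> measurable B ->
  (P (A `&` X i @^-1` B) = P A * P (X i @^-1` B))%E.
Proof.
move=> pA mB; pose E := X i @^-1` B.
have mE : measurable E by rewrite -[E]setTI; exact: measurable_funP.
pose boxes := [set A | exists2 C : nat -> set R, forall j, measurable (C j) &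
  A = \bigcap_(j in [set j | (j < i)%N]) X j @^-1` C j].
have mbox : boxes `<=` measurable.
  move=> _ [C mC ->]; apply: bigcap_measurableType => j _.
  by rewrite -[_ @^-1` _]setTI; exact: measurable_funP.
have msbox : <<s boxes >> `<=` measurable.
  by apply: smallest_sub => //; exact: sigma_algebra_measurable.
have boxI : setI_closed boxes.
  move=> _ _ [C mC ->] [C' mC' ->]; exists (fun j => C j `&` C' j).
    by move=> j; exact: measurableI.
  by rewrite -bigcapI; apply: eq_bigcapr => j _; rewrite preimage_setI.
have past_box : <<s past i >> `<=` <<s boxes >>.
  apply: sub_smallest2r; first exact: smallest_sigma_algebra.
  move=> _ [j /= ji [C mC <-]]; rewrite setTI.
  exists (fun k => if k == j then C else setT) => [k|]; first by case: ifP.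
  apply/seteqP; split=> [w Cw k /= ki|w /(_ j ji)]; last first.
    by rewrite /preimage/= eqxx.
  by case: eqP => [->|].
have indepC (S : set T) : measurable S ->
    (P (S `&` E) = P S * P E -> P (~` S `&` E) = P (~` S) * P E)%E.
  move=> mS; rewrite setIC => ES; rewrite setIC -setDE measureD//; last first.
    by apply: le_lt_trans (probability_le1 P mE) _; exact: ltry.
  transitivity (P E - P S * P E)%E; first by congr (_ - _)%E; exact: ES.
  by rewrite probability_setC// muleBl ?mul1e// ?fin_num_measure.
have indepU (S : (set T)^nat) : (forall k, measurable (S k)) ->
    trivIset setT S -> (forall k, P (S k `&` E) = P (S k) * P E)%E ->
    (P ((\bigcup_k S k) `&` E) = P (\bigcup_k S k) * P E)%E.
  move=> mS tS PS; rewrite setI_bigcupl measure_bigcup//; last 2 first.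
    by move=> k _; exact: measurableI.
    by under eq_fun do rewrite setIC; exact: trivIset_setIl.
  have PE : (fine (P E))%:E = P E by rewrite fineK ?fin_num_measure.
  rewrite measure_bigcup// muleC -PE -nneseriesZl//.
  by apply: eq_eseriesr => k _; rewrite PE muleC; exact: PS.
apply: (@dynkin_induction _ (g_sigma_algebraType boxes) boxes
  (fun A => P (A `&` E) = P A * P E)%E) => //; last exact: past_box.
- by rewrite setTI probability_setT mul1e.
- move=> _ [C mC ->].
  pose J := [fset j in iota 0 i]%fset.
  have JE : [set` J] = [set j | (j < i)%N].
    by apply/seteqP; split=> j /=; rewrite !inE mem_iota.
  have iJ : i \notin J by rewrite !inE mem_iota/= ltnn.
  (* [C'] places [B] at index [i], so that one family serves the product rule both over [J] and over
     [J] enlarged by [i]. *)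
  pose C' k := if k == i then B else C k.
  have mC' k : measurable (C' k) by rewrite /C'; case: ifP.
  have C'E j : (j < i)%N -> C' j = C j by rewrite /C' => /ltn_eqF ->.
  have -> : \bigcap_(j in [set j | (j < i)%N]) X j @^-1` C j =
            \bigcap_(j in [set` J]) X j @^-1` C' j.
    by rewrite JE; apply: eq_bigcapr => j /= ji; rewrite C'E.
  have -> : \bigcap_(j in [set` J]) X j @^-1` C' j `&` E =
      \bigcap_(j in [set` (i |` J)%fset]) X j @^-1` C' j.
    rewrite set_fsetU1 bigcap_setU1 setIC; congr (_ `&` _).
    by rewrite /C' eqxx.
  have -> : E = X i @^-1` C' i by rewrite /C' eqxx.
  by rewrite !X_indep// big_fsetU1//= muleC.
- by move=> S /msbox mS; exact: indepC.
- by move=> S mS tS; apply: indepU => // k; apply: msbox; exact: mS.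
Qed.

End Independence.

(* [<<s G i>>] is the information available strictly before time [i], and
   [D i] is the cell (out of [m] equiprobable ones) of the observation made at
   time [i]. *)
Record uniform_grid (R : realType) d (T : measurableType d)
    (P : probability T R) (G : nat -> set (set T)) (m : nat)
    (D : nat -> T -> nat) : Prop := UniformGrid {
  grid_measurable : forall i, <<s G i >> `<=` measurable ;
  grid_mono : forall i, <<s G i >> `<=` <<s G i.+1 >> ;
  grid_lt : forall i w, (D i w < m)%N ;
  grid_simple : forall i, @simple _ (g_sigma_algebraType (G i.+1)) _ (D i) ;
  grid_indep : forall i u (A : set T), (u < m)%N -> <<s G i >> A ->
    (P (A `&` [set w | D i w = u]) = P A * (m%:R^-1)%:E)%E }.

Section Grid.
Context (R : realType) d (T : measurableType d) (P : probability T R).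
Variables (G : nat -> set (set T)) (m : nat) (D : nat -> T -> nat).
Hypothesis gridD : uniform_grid P G m D.

Lemma simple_next i (K : Type) (Y : T -> K) :
  @simple _ (g_sigma_algebraType (G i)) _ Y ->
  @simple _ (g_sigma_algebraType (G i.+1)) _ Y.
Proof.
apply: (@simple_sub _ _ (g_sigma_algebraType (G i.+1))
  (g_sigma_algebraType (G i)) _ idfun Y); exact: (grid_mono gridD).
Qed.

Lemma simple_grid i (K : Type) (Y : T -> K) :
  @simple _ (g_sigma_algebraType (G i)) _ Y -> simple Y.
Proof.
apply: (@simple_sub _ _ T (g_sigma_algebraType (G i)) _ idfun Y).
exact: (grid_measurable gridD).
Qed.

(** The cell [D i] is uniform and independent of the past, so integrating it out with the
    past-measurable [Y] frozen leaves an average over all cells. Every moment recursion below rests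
    on this. *)
Lemma Ex_step i (K : Type) (Y : T -> K) (h : K -> nat -> R) :
    @simple _ (g_sigma_algebraType (G i)) _ Y ->
  Ex P (fun w => h (Y w) (D i w)) =
  Ex P (fun w => (\sum_(u < m) h (Y w) u) / m%:R).
Proof.
move=> sY.
have mD u : measurable [set w | D i w = u].
  exact: (grid_measurable gridD) ((grid_simple gridD i).2 [set u]).
have shY u : @simple _ (g_sigma_algebraType (G i)) _ (fun w => h (Y w) u).
  exact: (simple_comp (fun y => h y u) sY).
have shY' u : simple (fun w => h (Y w) u) by exact: simple_grid (shY u).
transitivity (Ex P (fun w => \sum_(u < m)
    h (Y w) u * \1_([set w | D i w = u]) w)).
  congr Ex; apply/funext => w.
  rewrite (bigD1 (Ordinal (grid_lt gridD i w)))//= big1 => [|u /negP uD].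
    by rewrite indicE mem_set// mulr1 addr0.
  rewrite indicE memNset ?mulr0//= => Du; apply: uD; apply/eqP/val_inj.
  by rewrite /= Du.
rewrite Ex_sum; last first.
  by move=> u; apply: simple_comp2; [exact: shY'|exact: simple_indic].
transitivity (Ex P (fun w => m%:R^-1 * \sum_(u < m) h (Y w) u)); last first.
  by congr Ex; apply/funext => w; rewrite mulrC.
rewrite ExZ ?Ex_sum//; last first.
  by apply: simple_sum => u; exact: shY'.
rewrite mulr_sumr; apply: eq_bigr => u _.
rewrite [RHS]mulrC; apply: (@Ex_indep _ _ _ P (G i)) (shY u) => //.
- exact: (grid_measurable gridD).
- by move=> A GA; exact: (grid_indep gridD).
Qed.

(** Together with [uniform_grid_rev], this lets the falling phase be analysed as a rising one: the
    clock restarts at [s] and the cells are reflected. *)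
Lemma uniform_grid_shift s :
  uniform_grid P (fun j => G (s + j)%N) m (fun j => D (s + j)%N).
Proof.
split=> *.
- exact: (grid_measurable gridD).
- by rewrite addnS; exact: (grid_mono gridD).
- exact: (grid_lt gridD).
- by rewrite addnS; exact: (grid_simple gridD).
- exact: (grid_indep gridD).
Qed.

Lemma uniform_grid_rev : uniform_grid P G m (fun i w => m.-1 - D i w)%N.
Proof.
split=> [||i w|i|i u A um GA].
- exact: (grid_measurable gridD).
- exact: (grid_mono gridD).
- have := grid_lt gridD i w; lia.
- by apply: (simple_comp (fun u => m.-1 - u)%N); exact: (grid_simple gridD).
- rewrite -(grid_indep gridD (u := (m.-1 - u)%N) _ GA); last lia.
  congr (P (_ `&` _)); apply/seteqP.
  by split=> w /=; have := grid_lt gridD i w; lia.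
Qed.

End Grid.

(** A downward closed predicate holds on an initial segment of 1..n, whose length is the count. This
    turns a bound on the cell of a point into a comparison with a single quantile. *)
Lemma count_iota_antitone (p : pred nat) (n k : nat) :
    (forall i j, (0 < i < j)%N -> (j <= n)%N -> p j -> p i) -> (k < n)%N ->
  (k < count p (iota 1 n))%N = p k.+1.
Proof.
move=> p_anti kn.
have -> : iota 1 n = iota 1 k ++ k.+1 :: iota k.+2 (n - k.+1).
  have -> : n = (k + (n - k.+1).+1)%N by lia.
  by rewrite iotaD add1n /=; congr (_ ++ _ :: iota _ _); lia.
rewrite count_cat /=; case: (boolP (p k.+1)) => [pk|npk].
  rewrite (_ : count p (iota 1 k) = k) ?add1n ?addnS ?ltnS ?leq_addr//.
  rewrite -[RHS](size_iota 1 k); apply/eqP; rewrite -all_count.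
  apply/allP => i; rewrite mem_iota => ik; apply: p_anti pk; lia.
rewrite add0n (_ : count p (iota k.+2 _) = 0%N) ?addn0.
  have := count_size p (iota 1 k); rewrite size_iota; lia.
apply/eqP; rewrite -leqn0 leqNgt -has_count; apply/hasPn => j.
rewrite mem_iota => kj; apply: contra npk; apply: p_anti; lia.
Qed.

(** * Construction of the quantile cells *)

Section QuantileGrid.
Context (R : realType) d (T : measurableType d) (P : probability T R).
Variables (X : nat -> {RV P >-> R}) (F : R -> R).
Hypothesis X_indep : mutually_independent X.
Hypothesis F_cont : continuous F.
Hypothesis X_cdf : forall i x, cdf (X i) x = (F x)%:E.

Lemma F_nondecreasing : {homo F : x y / x <= y}.
Proof.
move=> x y xy; rewrite -lee_fin -!(X_cdf 0).
exact: cdf_nondecreasing.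
Qed.

Lemma quantile_exists (t : R) : 0 < t < 1 -> exists q, F q = t.
Proof.
move=> /andP[t0 t1].
have FE : F = fine \o cdf (X 0%N) by apply/funext => x /=; rewrite X_cdf.
have [b tb] : exists b, t <= F b.
  have F1 : F x @[x --> +oo] --> (1 : R).
    by rewrite FE; exact: fine_cvg (cvg_cdfy1 _).
  have /filter_ex[b tb] : \forall x \near +oo, t < F x
    by exact: cvgr_gt F1 _ t1.
  by exists b; exact: ltW.
have [a ta] : exists a, F a <= t.
  have F0 : F x @[x --> -oo] --> (0 : R).
    by rewrite FE; exact: fine_cvg (cvg_cdfNy0 _).
  have /filter_ex[a ta] : \forall x \near -oo, F x < t
    by exact: cvgr_lt F0 _ t0.
  by exists a; exact: ltW.
(* If [b] lies to the left of [a], monotonicity forces [F a = t]; otherwise the intermediate value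
   theorem applies. *)
have [ab|/ltW ba] := leP a b; last first.
  by exists a; apply/eqP; rewrite eq_le ta (le_trans tb)// F_nondecreasing.
have [||q _ <-] := @IVT R F a b t ab; last by exists q.
  exact: continuous_subspaceT.
by rewrite ge_min ta /= le_max tb orbT.
Qed.

Lemma quantile_grid (m : nat) : (0 < m)%N ->
  exists2 cell : R -> nat, {homo cell : x y / x <= y >-> (x <= y)%N} &
    uniform_grid P (past X) m (fun i w => cell (X i w)).
Proof.
move=> m0; have m0R : 0 < m%:R :> R by rewrite ltr0n.
(* Only interior quantiles matter; the value 0 for other [k] is a dummy. *)
have /boolp.choice[q Fq] : forall k : nat, exists x : R,
    (0 < k < m)%N -> F x = k%:R / m%:R.
  move=> k; have [/andP[k0 km]|_] := boolP (0 < k < m)%N; last by exists 0.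
  have [|x Fx] := @quantile_exists (k%:R / m%:R); last by exists x.
  by rewrite divr_gt0 ?ltr0n//= ltr_pdivrMr// mul1r ltr_nat.
have q_lt j k : (0 < j)%N -> (j < k)%N -> (k < m)%N -> q j < q k.
  move=> j0 jk km; rewrite ltNge; apply/negP => /F_nondecreasing.
  rewrite !Fq ?km ?j0 ?andbT//=; try lia.
  by rewrite leNgt ltr_pM2r ?invr_gt0// ltr_nat jk.
(* Counting quantiles strictly below [x] makes the cells intervals closed on the right, which
   matches the cdf: the event that the cell is at most [k] has probability [F (q k.+1)]. *)
pose cell x := count (fun k => q k < x) (iota 1 m.-1).
have cell_homo : {homo cell : x y / x <= y >-> (x <= y)%N}.
  by move=> x y xy; apply: sub_count => k /= /lt_le_trans; exact.
have cell_lt x : (cell x < m)%N.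
  have := count_size (fun k => q k < x) (iota 1 m.-1).
  by rewrite size_iota -/(cell x); lia.
have cell_le x k : (k.+1 < m)%N -> (cell x <= k)%N = (x <= q k.+1).
  move=> km; rewrite leNgt leqNgt; congr (~~ _).
  apply: (count_iota_antitone (p := fun k => q k < x)); last lia.
  by move=> i j /andP[i0 ij] jm; apply: lt_trans; apply: q_lt; lia.
have cell_simple : simple cell.
  have -> : cell = (fun x => \sum_(k <- iota 1 m.-1) nat_of_bool (q k < x)%R)%N.
    apply/funext => x; rewrite /cell -sum1_count [LHS]big_mkcond.
    by apply: eq_bigr => k _; case: ifP.
  apply: (@simple_sum _ _ nat) => k; apply: (simple_comp nat_of_bool).
  apply: simple_bool; rewrite (_ : [set _ | _] = `]q k, +oo[%classic)//.
  by apply/seteqP; split=> x /=; rewrite in_itv/= andbT.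
have mX i B : measurable B -> measurable (X i @^-1` B).
  by move=> mB; rewrite -[_ @^-1` _]setTI; exact: measurable_funP.
have P_cell_le i k : (k < m)%N ->
    (P (X i @^-1` [set x | (cell x <= k)%N]) = (k.+1%:R / m%:R)%:E)%E.
  move=> km; have [km1|] := ltnP k.+1 m.
    rewrite -Fq ?km1// -(X_cdf i) /cdf; congr (P (X i @^-1` _)).
    by apply/seteqP; split=> x /=; rewrite in_itv/= cell_le.
  (* The top cell has no upper quantile; the event is then the whole space. *)
  move=> mk; have -> : k.+1 = m by lia.
  rewrite divff ?gt_eqF// -[RHS](probability_setT P); congr (P _).
  by apply/seteqP; split=> w //= _; have := cell_lt (X i w); lia.
have P_cell i u : (u < m)%N ->
    (P (X i @^-1` [set x | cell x = u]) = (m%:R^-1)%:E)%E.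
  case: u => [|u] um.
    rewrite -[m%:R^-1]mul1r -(P_cell_le i 0%N um); congr (P (X i @^-1` _)).
    by apply/seteqP; split=> x /=; rewrite leqn0 => /eqP.
  (* The mass of one cell is the difference of two consecutive cumulative masses. *)
  pose E := X i @^-1` [set x | cell x = u.+1].
  pose L := X i @^-1` [set x | (cell x <= u)%N].
  have mE : measurable E by exact: mX i _ (cell_simple.2 [set u.+1]).
  have mL : measurable L by exact: mX i _ (cell_simple.2 [set k | (k <= u)%N]).
  have PEL : (P (E `|` L) = P E + P L)%E.
    by apply: measureU => //; apply/seteqP; split=> w []; rewrite /E /L /=; lia.
  have := P_cell_le i u.+1 um.
  rewrite (_ : _ @^-1` _ = E `|` L); last first.
    by apply/seteqP; split=> w; rewrite /E /L /=; lia.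
  rewrite PEL P_cell_le; last lia.
  rewrite -[P E]fineK ?fin_num_measure// -EFinD => -[PE].
  congr EFin; apply: (addIr (u.+1%:R / m%:R)).
  by rewrite [LHS]PE -[in LHS]natr1 mulrDl mul1r addrC.
exists cell => //; split=> [i|i|i w|i|i u A um pA] //.
- exact: past_measurable.
- exact: past_mono.
- apply: (@simple_sub _ _ (g_sigma_algebraType (past X i.+1)) R _ (X i)) => //.
  move=> B mB; apply: sub_sigma_algebra; exists i => //=.
  by exists B => //; rewrite setTI.
- rewrite -(P_cell i u um); apply: (past_indep X_indep pA).
  exact: (cell_simple.2 [set u]).
Qed.

End QuantileGrid.

(** * Second moment of a feasible policy *)

Section Potential.
Variables (M L : nat).

(* Unfold the cells 0..M to positions 0..2M: cell [u] sits at [u] on the rising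
   branch and at [2M - u] on the falling one.  [cost v u] is the advance from
   position [v] to the first admissible position of [u]; the value [L] is a
   dummy, when no position of [u] is admissible. *)
Definition cost (v u : nat) : nat :=
  if (v <= u)%N then (u - v)%N
  else if (v <= M.*2 - u)%N then (M.*2 - u - v)%N else L.

Fixpoint potential (a : nat -> bool) (D : nat -> nat) (i : nat) : nat :=
  if i is j.+1 then
    if a j then (potential a D j + cost (potential a D j) (D j))%N
    else potential a D j
  else 0%N.

(** The sum runs over all observations, accepted or not, so that the conditional mean of an
    increment is bounded uniformly in the policy. *)
Fixpoint excess (a : nat -> bool) (D : nat -> nat) (i : nat) : nat :=
  if i is j.+1 then
    (excess a D j + (L - cost (potential a D j) (D j)))%N
  else 0%N.

(* An accepted cell of cost [c] contributes [c] to the potential and [L - c]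
   (truncated) to the excess, hence at least [L] in total. *)
Lemma accepted_le (a : nat -> bool) (D : nat -> nat) (n : nat) :
  (L * \sum_(i < n) a i <= potential a D n + excess a D n)%N.
Proof.
elim: n => [|n IH]; first by rewrite big_ord0 muln0.
rewrite big_ord_recr/= mulnDr; case: (a n) => /=; rewrite ?muln1 ?muln0.
  by apply: leq_trans (leq_add IH (leqnn L)) _; lia.
by rewrite addn0; apply: leq_trans IH _; lia.
Qed.

Lemma potentialE (a : nat -> bool) (D : nat -> nat) (n : nat) :
  potential a D n =
  foldl (fun v u => v + cost v u)%N 0%N
    [seq D i | i <- [seq i <- iota 0 n | a i]].
Proof.
elim: n => // n IH.
rewrite -addn1 iotaD filter_cat map_cat foldl_cat -IH /= add0n addn1 /=.
by case: (a n).
Qed.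

(** Up to the peak, the position equals the current cell. Afterwards it is at most the falling
    position of the current cell: the falling position of the next cell is still ahead, and [cost]
    leads to the first admissible one. The dummy value [L] therefore never occurs. *)
Lemma potential_unimodal (s : seq nat) :
    (forall j, (nth 0%N s j) <= M)%N ->
    (exists t : nat, [/\ (t < size s)%N,
       forall j : nat, (j < t)%N -> (nth 0%N s j <= nth 0%N s j.+1)%N &
       forall j : nat, (t <= j)%N -> (j.+1 < size s)%N ->
         (nth 0%N s j.+1 <= nth 0%N s j)%N]) ->
  (foldl (fun v u => v + cost v u)%N 0%N s <= M.*2)%N.
Proof.
move=> sM [t [ts incr decr]].
pose v j := foldl (fun v u => v + cost v u)%N 0%N (take j s).
have v0 : v 0%N = 0%N by rewrite /v take0.
have vS j : (j < size s)%N -> v j.+1 = (v j + cost (v j) (nth 0%N s j))%N.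
  by move=> js; rewrite /v (take_nth 0%N js) -cats1 foldl_cat.
have up j : (j <= t)%N -> v j.+1 = (nth 0%N s j).
  elim: j => [_|j IH jt]; first by rewrite vS ?v0 /cost ?leq0n//=; lia.
  rewrite vS; last lia.
  rewrite IH; last lia.
  have := incr j jt; rewrite /cost => ->; have := incr j jt; lia.
have down j : (t + j < size s)%N ->
    (v (t + j).+1 <= M.*2 - nth 0%N s (t + j))%N.
  elim: j => [_|j IH]; first by rewrite addn0 up//; have := sM t; lia.
  rewrite addnS => js; have tjs : (t + j < size s)%N by lia.
  rewrite vS//; have := IH tjs.
  have := decr (t + j)%N (leq_addr _ _) js; have := sM (t + j).+1.
  rewrite /cost; case: ifP => ?; first lia.
  by case: ifP; lia.
have -> : foldl (fun v u => v + cost v u)%N 0%N s = v (size s).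
  by rewrite /v take_size.
have := down (size s - t.+1)%N.
have -> : (t + (size s - t.+1))%N = (size s).-1 by lia.
rewrite prednK; last lia.
by move=> /(_ ltac:(lia)); lia.
Qed.

End Potential.

(** Grouping the terms by the value of [c], each [k < L] occurs at most once, and the sum of [L - k]
    over these [k] is half of [L * L.+1]. *)
Lemma sum_sub_injective (m L : nat) (c : 'I_m -> nat) :
    (forall u v, (c u < L)%N -> c u = c v -> u = v) ->
  (2 * \sum_(u < m) (L - c u) <= L * L.+1)%N.
Proof.
move=> c_inj.
have -> : (\sum_(u < m) (L - c u) =
    \sum_(u < m) \sum_(k < L | k == c u :> nat) (L - k))%N.
  apply: eq_bigr => u _; have [cL|Lc] := ltnP (c u) L.
    by rewrite (big_pred1 (Ordinal cL)).
  rewrite big_pred0 => [|k]; first by apply/eqP; rewrite subn_eq0.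
  by apply/eqP => kc; have := ltn_ord k; lia.
rewrite (exchange_big_dep predT)//=.
apply: (@leq_trans (2 * \sum_(k < L) (L - k))).
  rewrite leq_mul2l/=; apply: leq_sum => k _.
  rewrite sum_nat_const -[leqRHS]mul1n leq_mul2r; apply/orP; right.
  apply/card_le1_eqP => u v uk vk.
  have /eqP ku : k == c u :> nat by exact: uk.
  have /eqP kv : k == c v :> nat by exact: vk.
  by apply: c_inj; rewrite -kv -?ku.
elim: L {c_inj} => [|L IH]; first by rewrite big_ord0.
rewrite big_ord_recl/= mulnDr; under eq_bigr do rewrite /bump/= add1n subSS.
by apply: leq_trans (leq_add (leqnn _) IH) _; nia.
Qed.

(** Distinct cells occupy distinct positions, so a cost below [L] belongs to one cell only; the
    dummy cost [L] has zero gain. *)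
Lemma sum_gain_le (m L v : nat) :
  (2 * \sum_(u < m) (L - cost m.-1 L v u) <= L * L.+1)%N.
Proof.
apply: sum_sub_injective => u u'; have := ltn_ord u; have := ltn_ord u'.
by rewrite /cost; do !case: ifP; move=> *; apply: val_inj => /=; lia.
Qed.

(** * Moments of the excess and of the number of selections *)

Section SecondMoment.
Context (R : realType) d (T : measurableType d) (P : probability T R).
Variables (G : nat -> set (set T)) (m : nat) (D : nat -> T -> nat).
Hypothesis gridD : uniform_grid P G m D.
Variables (L n : nat) (a : nat -> T -> bool).
Hypothesis m_gt0 : (0 < m)%N.
Hypothesis simple_a : forall i,
  @simple _ (g_sigma_algebraType (G i.+1)) _ (a i).

Let V i w := potential m.-1 L (a ^~ w) (D ^~ w) i.
Let S i w := excess m.-1 L (a ^~ w) (D ^~ w) i.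
(** Upper bound for the conditional mean of one increment of the excess. *)
Let zeta : R := (L * L.+1)%:R / (2 * m)%:R.

Hypothesis V_le : forall w, (V n w <= m.-1.*2)%N.

Let simple_V i : @simple _ (g_sigma_algebraType (G i)) _ (V i).
Proof.
elim: i => [|i IH]; first exact: simple_cst.
have /= sY := simple_pair (simple_next gridD IH)
  (simple_pair (simple_a i) (grid_simple gridD i)).
exact: (simple_comp (fun y : nat * (bool * nat) =>
  if y.2.1 then (y.1 + cost m.-1 L y.1 y.2.2)%N else y.1) sY).
Qed.

Let simple_S i : @simple _ (g_sigma_algebraType (G i)) _ (S i).
Proof.
elim: i => [|i IH]; first exact: simple_cst.
have /= sY := simple_pair (simple_next gridD IH)
  (simple_pair (simple_next gridD (simple_V i)) (grid_simple gridD i)).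
exact: (simple_comp (fun y : nat * (nat * nat) =>
  (y.1 + (L - cost m.-1 L y.2.1 y.2.2))%N) sY).
Qed.

Let mean_gain v : (\sum_(u < m) (L - cost m.-1 L v u)%:R) / m%:R <= zeta.
Proof.
have m0 : 0 < m%:R :> R by rewrite ltr0n.
rewrite /zeta [(2 * m)%:R]natrM invfM mulrA ler_pM2r ?invr_gt0// ler_pdivlMr//.
by rewrite -natr_sum mulrC -natrM ler_nat; exact: sum_gain_le.
Qed.

Let zeta_ge0 : 0 <= zeta. Proof. by rewrite divr_ge0. Qed.

Let Ex_S i : Ex P (fun w => (S i w)%:R) <= i%:R * zeta.
Proof.
elim: i => [|i IH]; first by rewrite mul0r Ex_cst.
have sVS := simple_pair (simple_V i) (simple_S i).
have sS : simple (fun w => (S i w)%:R : R).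
  exact: (simple_comp (fun s => s%:R)) (simple_grid gridD (simple_S i)).
have /= := Ex_step gridD (fun (y : nat * nat) u =>
  (y.2 + (L - cost m.-1 L y.1 u))%:R : R) sVS.
rewrite -[X in X = _]/(Ex P (fun w => (S i.+1 w)%:R)) => ->.
apply: (@le_trans _ _ (Ex P (fun w => (S i w)%:R + zeta))); last first.
  rewrite ExD ?Ex_cst//; last exact: simple_cst.
  by rewrite -natr1 mulrDl mul1r lerD2r.
apply: Ex_le.
- apply: (simple_grid gridD (i := i)).
    exact: (simple_comp (fun y : nat * nat => (\sum_(u < m)
    (y.2 + (L - cost m.-1 L y.1 u))%:R) / m%:R : R) sVS).
- by apply: simple_comp2 => //; exact: simple_cst.
- move=> w; under eq_bigr do rewrite natrD.
  rewrite big_split/= sumr_const card_ord mulrDl.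
  by rewrite -[X in X / _]mulr_natr mulfK ?pnatr_eq0 -?lt0n// lerD2l.
Qed.

(** An increment [g] lies between 0 and [L], so its square is at most [L * g]; one step thus adds at
    most [(2 * S + L) * zeta] to the conditional second moment. *)
Let Ex_S2 i :
  Ex P (fun w => (S i w)%:R ^+ 2) <= (i%:R * zeta) ^+ 2 + i%:R * L%:R * zeta.
Proof.
elim: i => [|i IH].
  have -> : (fun w => (S 0 w)%:R ^+ 2) = fun=> (0 : R).
    by apply/funext => w; rewrite /S/= expr0n.
  by rewrite !mul0r expr0n addr0 Ex_cst.
have sVS := simple_pair (simple_V i) (simple_S i).
have sS : simple (fun w => (S i w)%:R : R).
  exact: (simple_comp (fun s => s%:R)) (simple_grid gridD (simple_S i)).
have sS2 : simple (fun w => (S i w)%:R ^+ 2 : R).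
  exact: (simple_comp (fun x => x ^+ 2)) sS.
have /= := Ex_step gridD (fun (y : nat * nat) u =>
  (y.2 + (L - cost m.-1 L y.1 u))%:R ^+ 2 : R) sVS.
rewrite -[X in X = _]/(Ex P (fun w => (S i.+1 w)%:R ^+ 2)) => ->.
apply: (@le_trans _ _ (Ex P (fun w =>
    (S i w)%:R ^+ 2 + ((2 * zeta) * (S i w)%:R + L%:R * zeta)))).
  apply: Ex_le.
  - apply: (simple_grid gridD (i := i)).
    exact: (simple_comp (fun y : nat * nat => (\sum_(u < m)
      (y.2 + (L - cost m.-1 L y.1 u))%:R ^+ 2) / m%:R : R) sVS).
  - exact: (simple_comp (fun x => x ^+ 2 + (2 * zeta * x + L%:R * zeta))) sS.
  - move=> w; set s : R := (S i w)%:R.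
    pose g u : R := (L - cost m.-1 L (V i w) u)%:R.
    apply: (@le_trans _ _
        ((\sum_(u < m) (s ^+ 2 + (2 * s + L%:R) * g u)) / m%:R)).
      rewrite ler_pM2r ?invr_gt0 ?ltr0n//; apply: ler_sum => u _.
      rewrite natrD -/s -/(g u).
      have g0 : 0 <= g u by exact: ler0n.
      have gL : g u <= L%:R by rewrite ler_nat leq_subr.
      nra.
    rewrite big_split/= sumr_const card_ord mulrDl -mulr_sumr.
    rewrite -[X in X / _ + _]mulr_natr mulfK ?pnatr_eq0 -?lt0n// lerD2l -mulrA.
    rewrite (_ : 2 * zeta * s + L%:R * zeta = (2 * s + L%:R) * zeta); last ring.
    apply: ler_wpM2l; last exact: mean_gain.
    by rewrite addr_ge0// mulr_ge0.
rewrite ExD//; last first.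
  exact: (simple_comp (fun x => 2 * zeta * x + L%:R * zeta)) sS.
rewrite ExD ?Ex_cst ?ExZ//; last 2 first.
- exact: (simple_comp ( *%R (2 * zeta))) sS.
- exact: simple_cst.
have := Ex_S i; have := zeta_ge0; rewrite -natr1; nra.
Qed.

(** Since [accepted_le] and [V_le] bound [L] times the count by [2 * m] plus the excess, it remains
    to expand the square and insert both moments of the excess. *)
Lemma second_moment_le :
  L%:R ^+ 2 * Ex P (fun w => (\sum_(i < n) a i w)%:R ^+ 2) <=
  ((2 * m)%:R + n%:R * zeta) ^+ 2 + n%:R * L%:R * zeta.
Proof.
have sS : simple (fun w => (S n w)%:R : R).
  exact: (simple_comp (fun s => s%:R)) (simple_grid gridD (simple_S n)).
have sN : simple (fun w => (\sum_(i < n) a i w)%N).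
  apply: (@simple_sum _ _ nat) => i; apply: (simple_comp nat_of_bool).
  by apply: (simple_grid gridD (i := i.+1)); exact: simple_a.
rewrite -ExZ; last exact: (simple_comp (fun k => k%:R ^+ 2 : R)) sN.
apply: (@le_trans _ _ (Ex P (fun w =>
    (2 * m)%:R ^+ 2 + ((2 * (2 * m)%:R) * (S n w)%:R + (S n w)%:R ^+ 2)))).
  apply: Ex_le.
  - exact: (simple_comp (fun k => L%:R ^+ 2 * k%:R ^+ 2 : R)) sN.
  - exact: (simple_comp (fun x =>
      (2 * m)%:R ^+ 2 + (2 * (2 * m)%:R * x + x ^+ 2))) sS.
  - move=> w; rewrite -exprMn.
    rewrite [leRHS](_ : _ = ((2 * m + S n w)%N)%:R ^+ 2); last first.
      by rewrite natrD; ring.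
    rewrite ler_pXn2r ?nnegrE ?mulr_ge0 ?ler0n// -natrM ler_nat.
    have := accepted_le m.-1 L (a ^~ w) (D ^~ w) n.
    have := V_le w; rewrite /V /S; lia.
have sS2 : simple (fun w => (S n w)%:R ^+ 2 : R).
  exact: (simple_comp (fun x => x ^+ 2)) sS.
rewrite ExD; last 2 first.
- exact: simple_cst.
- exact: (simple_comp (fun x => 2 * (2 * m)%:R * x + x ^+ 2)) sS.
rewrite Ex_cst ExD//; last exact: (simple_comp ( *%R (2 * (2 * m)%:R))) sS.
rewrite ExZ//.
have := Ex_S n; have := Ex_S2 n.
have : 0 <= (2 * m)%:R :> R by exact: ler0n.
nra.
Qed.

End SecondMoment.

(** * The window walk *)

Section Walk.
Variables (m L : nat).

(* Once the window no longer fits, it restarts at 0 although nothing is accepted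
   any more: this keeps the increments of [walk] i.i.d. at all times. *)
Definition window (v : nat) : nat := if (v + L <= m)%N then v else 0%N.

(** The successor moves the start of the window just beyond the accepted cell, so that later
    accepted cells are strictly larger. *)
Definition jump (v u : nat) : nat :=
  if (window v <= u < window v + L)%N then (u - window v).+1 else 0%N.

Fixpoint walk (D : nat -> nat) (j : nat) : nat :=
  if j is i.+1 then (walk D i + jump (walk D i) (D i))%N else 0%N.

Definition walk_accepts (D : nat -> nat) (j : nat) : bool :=
  (walk D j + L <= m)%N && (walk D j <= D j < walk D j + L)%N.

Lemma walk_homo D i j : (i <= j)%N -> (walk D i <= walk D j)%N.
Proof.
move=> /subnK <-; elim: (j - i)%N => // k IH.
by rewrite addSn /= (leq_trans IH)// leq_addr.
Qed.

(** Accepting [D i] moves the walk to [(D i).+1], and a later accepted cell is no lower than the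
    walk. *)
Lemma walk_accepts_lt D i j : (i < j)%N ->
  walk_accepts D i -> walk_accepts D j -> (D i < D j)%N.
Proof.
move=> /(walk_homo D) ij /andP[actI /andP[lo hi]] /andP[_ /andP[+ _]].
apply: leq_trans; apply: leq_trans ij; rewrite /= /jump /window actI lo hi/=.
lia.
Qed.

(** The window always fits among the [m] cells, so each value 1..L is taken exactly once, whatever
    [v] is: the law of a jump does not depend on the state. *)
Lemma sum_jump (R : nmodType) (g : nat -> R) v : (L <= m)%N -> g 0%N = 0 ->
  \sum_(u < m) g (jump v u) = \sum_(k < L) g k.+1.
Proof.
move=> Lm g0; set s := window v.
have sLm : (s + L <= m)%N by rewrite /s /window; case: ifP.
rewrite -(big_mkord predT (fun u => g (jump v u))).
rewrite (big_cat_nat (n := s))//=; last lia.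
rewrite (big_cat_nat (n := (s + L)%N) (m := s))//=; last lia.
rewrite big_nat_cond big1 => [|u]; last first.
  by rewrite /jump -/s => ?; rewrite ifF//; lia.
rewrite add0r [X in _ + X]big_nat_cond [X in _ + X]big1 => [|u]; last first.
  by rewrite /jump -/s => ?; rewrite ifF//; lia.
rewrite addr0 addnC -{1}[s]add0n big_addn addnK big_mkord.
apply: eq_bigr => k _; rewrite /jump -/s ifT; last by have := ltn_ord k; lia.
by rewrite addnK.
Qed.

Lemma sum_accepts (R : pzSemiRingType) v : (v + L <= m)%N ->
  \sum_(u < m) ((v <= u < v + L)%N : nat)%:R = L%:R :> R.
Proof.
move=> vLm; transitivity (\sum_(u < m) (0 < jump v u)%N%:R : R).
  by apply: eq_bigr => u _; rewrite /jump /window vLm; case: ifP.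
rewrite (sum_jump (g := fun k => (0 < k)%N%:R))//; last lia.
by rewrite sumr_const card_ord.
Qed.

End Walk.

(** * Deviation of the walk and expected number of acceptances *)

Section WalkExpectation.
Context (R : realType) d (T : measurableType d) (P : probability T R).
Variables (G : nat -> set (set T)) (m : nat) (D : nat -> T -> nat).
Hypothesis gridD : uniform_grid P G m D.
Variables (L : nat).
Hypothesis Lm : (L <= m)%N.
Hypothesis m_gt0 : (0 < m)%N.

Let V i w := walk m L (D ^~ w) i.
Let acc i w := walk_accepts m L (D ^~ w) i.
Let mu : R := (L * L.+1)%:R / (2 * m)%:R.

Lemma simple_walk i : @simple _ (g_sigma_algebraType (G i)) _
  (fun w => walk m L (D ^~ w) i).
Proof.
elim: i => [|i IH]; first exact: simple_cst.
have /= sY := simple_pair (simple_next gridD IH) (grid_simple gridD i).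
exact: (simple_comp (fun y : nat * nat => (y.1 + jump m L y.1 y.2)%N) sY).
Qed.

Lemma simple_walk_accepts i : @simple _ (g_sigma_algebraType (G i.+1)) _
  (fun w => walk_accepts m L (D ^~ w) i).
Proof.
have /= sY := simple_pair (simple_next gridD (simple_walk i))
  (grid_simple gridD i).
exact: (simple_comp (fun y : nat * nat => (y.1 + L <= m)%N &&
  (y.1 <= y.2 < y.1 + L)%N) sY).
Qed.

Let simple_f i (f : nat -> R) : simple (fun w => f (V i w)).
Proof.
apply: (simple_grid gridD (i := i)); exact: (simple_comp f (simple_walk i)).
Qed.

Let sum_jump1 v : \sum_(u < m) (jump m L v u)%:R = m%:R * mu.
Proof.
have m0 : m%:R != 0 :> R by rewrite pnatr_eq0 -lt0n.
rewrite (sum_jump (g := fun k => k%:R))// /mu.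
have -> : m%:R * ((L * L.+1)%:R / (2 * m)%:R) = (L * L.+1)%:R / 2 :> R.
  by rewrite [(2 * m)%:R]natrM; field.
elim: L => [|l IH]; first by rewrite big_ord0 mul0r.
by rewrite big_ord_recr/= IH -natr1 !natrM -!natr1; field.
Qed.

Let sum_jump2 v : \sum_(u < m) (jump m L v u)%:R ^+ 2 <= L%:R ^+ 3 :> R.
Proof.
rewrite (sum_jump (g := fun k => k%:R ^+ 2)) ?expr0n//.
have -> : L%:R ^+ 3 = \sum_(k < L) L%:R ^+ 2 :> R.
  by rewrite sumr_const card_ord exprSr mulr_natr.
by apply: ler_sum => k _; rewrite ler_pXn2r ?nnegrE ?ler0n// ler_nat.
Qed.

(** [mu] is the exact mean of a jump, so cross terms cancel and variances add; one jump has second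
    moment at most [L ^ 3 / m]. *)
Lemma walk_deviation i :
  Ex P (fun w => ((walk m L (D ^~ w) i)%:R - i%:R * mu) ^+ 2) <=
  i%:R * (L%:R ^+ 3 / m%:R).
Proof.
have m0 : m%:R != 0 :> R by rewrite pnatr_eq0 -lt0n.
elim: i => [|i IH].
  have -> : (fun w => ((walk m L (D ^~ w) 0)%:R - 0 * mu) ^+ 2) = fun=> 0 : R.
    by apply/funext => w; rewrite /= mul0r subr0 expr0n.
  by rewrite Ex_cst mul0r.
have := Ex_step gridD (fun v u =>
  ((v + jump m L v u)%N%:R - i.+1%:R * mu) ^+ 2 : R) (simple_walk i).
rewrite -[X in X = _]/(Ex P (fun w =>
  ((walk m L (D ^~ w) i.+1)%:R - i.+1%:R * mu) ^+ 2)) => ->.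
pose s : R := L%:R ^+ 3 / m%:R.
apply: (@le_trans _ _ (Ex P (fun w => ((V i w)%:R - i%:R * mu) ^+ 2 + s))).
  apply: Ex_le.
  - exact: (simple_f i (fun v => (\sum_(u < m)
      ((v + jump m L v u)%N%:R - i.+1%:R * mu) ^+ 2) / m%:R)).
  - exact: (simple_f i (fun v => (v%:R - i%:R * mu) ^+ 2 + s)).
  - move=> w; rewrite -/(V i w); set v := V i w; set x := v%:R - i%:R * mu.
    (* Averaged over [u], the first two terms give [x ^+ 2 - mu ^+ 2], and the last is at most
       [s]. *)
    rewrite (eq_bigr (fun u : 'I_m => (x - mu) ^+ 2 +
        ((2 * (x - mu)) * (jump m L v u)%:R + (jump m L v u)%:R ^+ 2)));
      last first.
      by move=> u _; rewrite natrD -natr1 /x; ring.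
    rewrite !big_split/= sumr_const card_ord -mulr_sumr sum_jump1.
    have := sum_jump2 v; set q := \sum_(_ < _) _ ^+ 2 => qL.
    have qs : q / m%:R <= s by rewrite ler_pM2r// invr_gt0 ltr0n.
    rewrite -mulr_natr.
    rewrite (_ : (_ + _) / _ = x ^+ 2 - mu ^+ 2 + q / m%:R); last by field.
    by have := sqr_ge0 mu; lra.
rewrite ExD ?Ex_cst; last 2 first.
- exact: (simple_f i (fun v => (v%:R - i%:R * mu) ^+ 2)).
- exact: simple_cst.
by rewrite -natr1 mulrDl mul1r lerD2r.
Qed.

(** While the window fits, each step accepts with conditional probability [L / m]. By monotonicity,
    a window that fits at time [h] fitted at all earlier times, and Chebyshev's inequality with
    margin [t] bounds the probability that it fails to fit. *)
Lemma Ex_walk_accepts_ge (h : nat) (t : R) :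
    0 < t -> t <= m%:R - L%:R - h%:R * mu ->
  h%:R * (L%:R / m%:R) * (1 - h%:R * (L%:R ^+ 3 / m%:R) / t ^+ 2) <=
  Ex P (fun w => (\sum_(j < h) walk_accepts m L (D ^~ w) j)%:R).
Proof.
move=> t0 tK; have m0 : 0 < m%:R :> R by rewrite ltr0n.
pose active i w : bool := (V i w + L <= m)%N.
have simple_active i : simple (fun w => (active i w)%:R : R).
  exact: (simple_f i (fun v => (v + L <= m)%N%:R)).
have active_h : 1 - h%:R * (L%:R ^+ 3 / m%:R) / t ^+ 2 <=
    Ex P (fun w => (active h w)%:R).
  pose dev w : R := ((V h w)%:R - h%:R * mu) ^+ 2.
  have simple_dev : simple dev.
    by exact: (simple_f h (fun v => (v%:R - h%:R * mu) ^+ 2)).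
  have dev_le : (t ^+ 2)^-1 * Ex P dev <= h%:R * (L%:R ^+ 3 / m%:R) / t ^+ 2.
    rewrite mulrC ler_pM2r ?invr_gt0 ?exprn_gt0//; exact: walk_deviation.
  (* Chebyshev in pointwise form: if the window no longer fits, the deviation of the walk exceeds
     [t]. *)
  apply: (@le_trans _ _ (Ex P (fun w => 1 + (- (t ^+ 2)^-1) * dev w))).
    rewrite ExD ?Ex_cst ?ExZ//; last 2 first.
    - exact: simple_cst.
    - exact: (simple_comp ( *%R (- (t ^+ 2)^-1))) simple_dev.
    by rewrite mulNr lerD2l lerN2.
  apply: Ex_le => //.
  - exact: (simple_comp (fun x => 1 + - (t ^+ 2)^-1 * x)) simple_dev.
  - move=> w; rewrite /active mulNr; have [_|] := leqP.
      by rewrite /= gerBl mulr_ge0 ?invr_ge0 ?sqr_ge0.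
    rewrite -(ltr_nat R) natrD => mV; rewrite subr_le0 mulrC.
    rewrite ler_pdivlMr ?exprn_gt0// mul1r /dev.
    by rewrite ler_pXn2r ?nnegrE//; lra.
have simple_acc j : simple (fun w => (acc j w)%:R : R).
  apply: (simple_comp (fun b : bool => b%:R)).
  by apply: (simple_grid gridD (i := j.+1)); exact: simple_walk_accepts.
have Ex_acc j : Ex P (fun w => (acc j w)%:R) =
    L%:R / m%:R * Ex P (fun w => (active j w)%:R).
  have := Ex_step gridD (fun v u =>
    ((v + L <= m)%N && (v <= u < v + L)%N)%:R : R) (simple_walk j).
  rewrite -[X in X = _]/(Ex P (fun w => (acc j w)%:R)) => ->.
  rewrite -ExZ//; congr Ex; apply/funext => w; rewrite /active -/(V j w).
  case: leqP => vL /=; first by rewrite sum_accepts// mulr1.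
  by rewrite big1// mul0r mulr0.
have -> : (fun w => (\sum_(j < h) walk_accepts m L (D ^~ w) j)%:R : R) =
    (fun w => \sum_(j < h) (acc j w)%:R).
  by apply/funext => w; rewrite natr_sum.
rewrite (Ex_sum P _ (W := fun (j : 'I_h) w => (acc j w)%:R))//.
apply: (@le_trans _ _ (\sum_(j < h)
    L%:R / m%:R * Ex P (fun w => (active h w)%:R))).
  rewrite sumr_const card_ord -[leRHS]mulr_natl -[leLHS]mulrA.
  by do 2 (apply: ler_wpM2l; first by rewrite ?divr_ge0).
apply: ler_sum => j _; rewrite Ex_acc.
apply: ler_wpM2l; first by rewrite divr_ge0.
apply: Ex_le => // w; rewrite ler_nat /active.
case: (boolP (V h w + L <= m)%N) => // hL.
by rewrite (leq_trans _ hL)// leq_add2r; exact/walk_homo/ltnW.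
Qed.

End WalkExpectation.

(** * A nearly optimal policy *)

Section Policies.
Context (R : realType) d (T : measurableType d) (P : probability T R).
Variables (X : nat -> {RV P >-> R}).

(** Extension by [false] to all times, as the recursions over [nat] require. *)
Definition accepts (n : nat) (a : policy T n) (i : nat) (w : T) : bool :=
  oapp (fun j => a j w) false (insub i).

Lemma num_selectedE n (a : policy T n) w :
  num_selected a w = (\sum_(i < n) accepts a i w)%N.
Proof.
rewrite /num_selected /selected size_filter -sum1_count big_mkcond.
rewrite big_enum; apply: eq_bigr => i _.
by rewrite /accepts valK /=; case: ifP.
Qed.

Lemma selected_val n (a : policy T n) w :
  [seq val i | i <- selected a w] = [seq i <- iota 0 n | accepts a i w].
Proof.
rewrite -val_enum_ord filter_map; congr (map _ _).
by apply: eq_filter => i; rewrite /accepts /= valK.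
Qed.

Lemma simple_accepts n (a : policy T n) i : feasible X a ->
  @simple _ (g_sigma_algebraType (past X i.+1)) _ (accepts a i).
Proof.
move=> [meas_a _]; apply: simple_bool; rewrite /accepts.
case: insubP => [j _ <-|_] /=; first exact: meas_a.
by rewrite (_ : [set _ | _] = set0)//; apply/seteqP; split=> w.
Qed.

Lemma simple_num_selected n (a : policy T n) : feasible X a ->
  simple (num_selected a).
Proof.
move=> feas_a; rewrite (_ : num_selected a =
    fun w => (\sum_(i < n) accepts a i w)%N); last first.
  by apply/funext => w; exact: num_selectedE.
apply: (@simple_sum _ _ nat) => i; apply: (simple_comp nat_of_bool).
apply: (@simple_sub _ _ T (g_sigma_algebraType (past X i.+1)) _ idfun
  (accepts a i)); first by move=> A; exact: past_measurable.
exact: simple_accepts.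
Qed.

(** A monotone map preserves unimodality, so [potential_unimodal] applies to the cells of the
    selected values. *)
Lemma potential_feasible n (a : policy T n) (m L : nat) (cell : R -> nat) w :
    {homo cell : x y / x <= y >-> (x <= y)%N} ->
    (forall i, (cell (X i w) < m)%N) ->
    feasible X a ->
  (potential m.-1 L (accepts a ^~ w) (fun i => cell (X i w)) n <= m.-1.*2)%N.
Proof.
move=> cell_homo cell_lt [_ /(_ w)[t [ts incr decr]]].
set xs := [seq X i w | i : 'I_n <- selected a w] in ts incr decr.
have -> : potential m.-1 L (accepts a ^~ w) (fun i => cell (X i w)) n =
    foldl (fun v u => v + cost m.-1 L v u)%N 0%N [seq cell x | x <- xs].
  by rewrite potentialE -selected_val -!map_comp.
have nthE j : (j < size xs)%N -> nth 0%N [seq cell x | x <- xs] j = cell xs`_j.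
  exact: nth_map.
apply: potential_unimodal => [j|].
  have [js|js] := ltnP j (size xs); last first.
    by rewrite nth_default ?leq0n// size_map.
  have /mapP[i _ xsj] := mem_nth 0 js.
  by rewrite nthE// xsj; have := cell_lt i; lia.
exists t; rewrite size_map; split => // j jt.
  rewrite !nthE ?(leq_ltn_trans jt)// ?(ltn_trans jt)//.
  exact/cell_homo/incr.
by move=> js; rewrite !nthE ?(ltnW js)//; exact/cell_homo/decr.
Qed.

(** The peak is the last entry of [s1] or the first of [s2], whichever is larger. *)
Lemma unimodal_cat (s1 s2 : seq R) : s1 ++ s2 <> [::] ->
    pairwise <=%R s1 -> pairwise >=%R s2 -> unimodal (s1 ++ s2).
Proof.
move=> ne /(pairwiseP 0) inc /(pairwiseP 0) dec.
have step1 j : (j.+1 < size s1)%N -> (s1 ++ s2)`_j <= (s1 ++ s2)`_j.+1.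
  by move=> js; rewrite !nth_cat js (ltnW js); apply: inc; rewrite ?inE// ltnW.
have step2 j : (size s1 <= j)%N -> (j.+1 < size (s1 ++ s2))%N ->
    (s1 ++ s2)`_j.+1 <= (s1 ++ s2)`_j.
  rewrite size_cat => sj js; rewrite !nth_cat !ltnNge sj (leqW sj)/=.
  have d1 : (j - size s1 < size s2)%N by lia.
  have d2 : (j.+1 - size s1 < size s2)%N by lia.
  have d3 : (j - size s1 < j.+1 - size s1)%N by lia.
  exact: dec d1 d2 d3.
have [/size0nil s2_0|s2gt] := posnP (size s2).
  move: ne step1; rewrite s2_0 cats0 => ne step1.
  have s1N : (0 < size s1)%N by case: (s1) ne.
  exists (size s1).-1; split; first lia.
    by move=> j js; apply: step1; lia.
  by move=> j; lia.
have [s1_0|s1gt] := posnP (size s1).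
  exists 0%N; split => //; first by rewrite size_cat; lia.
  by move=> j _; apply: step2; lia.
have [up|/ltW down] := leP ((s1 ++ s2)`_(size s1).-1) ((s1 ++ s2)`_(size s1)).
  exists (size s1); split; first by rewrite size_cat; lia.
    move=> j js; have [|js1] := ltnP j.+1 (size s1); first exact: step1.
    have -> : j = (size s1).-1 by lia.
    by rewrite prednK.
  by move=> j; exact: step2.
exists (size s1).-1; split; first by rewrite size_cat; lia.
  by move=> j js; apply: step1; lia.
move=> j js1 js; have [js2|] := ltnP j (size s1); last first.
  by move=> js2; exact: step2 js2 js.
have -> : j = (size s1).-1 by lia.
by rewrite prednK.
Qed.

End Policies.

(** * The policy rising on the first half and falling on the second *)

Section TwoPhasePolicy.
Context (R : realType) d (T : measurableType d) (P : probability T R).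
Variables (X : nat -> {RV P >-> R}) (cell : R -> nat) (m L n h : nat).
Hypothesis cell_homo : {homo cell : x y / x <= y >-> (x <= y)%N}.
Let D i w := cell (X i w).
Let D' j w := (m.-1 - D (h + j) w)%N.
Hypothesis gridD : uniform_grid P (past X) m D.

Definition two_phase (i : nat) (w : T) : bool :=
  if (i < h)%N then walk_accepts m L (D ^~ w) i
  else walk_accepts m L (D' ^~ w) (i - h).

(* A feasible policy must select something on every outcome, so the last
   observation is accepted when nothing has been selected before. *)
Definition two_phase_policy : policy T n := fun i w =>
  two_phase i w || (i == n.-1 :> nat) && (\sum_(j < i) two_phase j w == 0)%N.

Let gridD' : uniform_grid P (fun j => past X (h + j)) m D'.
Proof. exact: uniform_grid_rev (uniform_grid_shift gridD h). Qed.

Lemma simple_two_phase i k : (i < k)%N ->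
  @simple _ (g_sigma_algebraType (past X k)) _ (two_phase i).
Proof.
move=> ik.
apply: (@simple_sub _ _ (g_sigma_algebraType (past X k))
  (g_sigma_algebraType (past X i.+1)) _ idfun (two_phase i)).
  by move=> A; exact: past_mono.
rewrite /two_phase; case: ltnP => hi; first exact: (simple_walk_accepts gridD).
by have := simple_walk_accepts gridD' L (i - h); rewrite addnS subnKC.
Qed.

Lemma two_phase_policy_feasible : (0 < n)%N -> feasible X two_phase_policy.
Proof.
move=> n_gt0; split=> [i|w].
  have s0 : @simple _ (g_sigma_algebraType (past X i.+1)) _
      (fun w => \sum_(j < i) two_phase j w)%N.
    apply: (@simple_sum _ _ nat) => j; apply: (simple_comp nat_of_bool).
    by apply: simple_two_phase; exact: leqW.
  have [_ /(_ [set true])] := simple_comp2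
    (fun b k => b || (i == n.-1 :> nat) && (k == 0)%N)
    (simple_two_phase (ltnSn i)) s0.
  exact.
have [/existsP[i0 pi0]|/existsPn none] :=
    boolP [exists i : 'I_n, two_phase i w]; last first.
  have lastP : (n.-1 < n)%N by lia.
  have -> : selected two_phase_policy w = [:: Ordinal lastP].
    rewrite -(filter_pred1_uniq (enum_uniq 'I_n) (mem_enum _ (Ordinal lastP))).
    apply: eq_filter => i; rewrite /two_phase_policy (negbTE (none i))/=.
    rewrite big1 ?andbT// => j _.
    have jn : (j < n)%N by exact: ltn_trans (ltn_ord j) (ltn_ord i).
    by rewrite (negbTE (none (Ordinal jn))).
  by exists 0%N.
(* Once some [i0] is picked, the fallback never fires: if the last time is not picked by
   [two_phase], then [i0] precedes it and the sum is nonzero. *)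
have sE : selected two_phase_policy w =
    [seq i : 'I_n <- enum 'I_n | two_phase i w].
  apply: eq_filter => i; rewrite /two_phase_policy.
  case: (boolP (two_phase i w)) => //= npi; apply/negP => /andP[/eqP iE].
  rewrite sum_nat_eq0 => /forallP/= all0.
  have i0i : (i0 < i)%N.
    rewrite ltn_neqAle; apply/andP; split; last by have := ltn_ord i0; lia.
    by apply: contra npi => /eqP <-.
  by have := all0 (Ordinal i0i); rewrite /= pi0.
have vals : pairwise ltn [seq val i | i <- enum 'I_n].
  by rewrite val_enum_ord -(sorted_pairwise ltn_trans) iota_ltn_sorted.
pose s1 := [seq i : 'I_n <- take h (enum 'I_n) | two_phase i w].
pose s2 := [seq i : 'I_n <- drop h (enum 'I_n) | two_phase i w].
have s12 : selected two_phase_policy w = s1 ++ s2.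
  by rewrite sE -filter_cat cat_take_drop.
have X_le i j : (D i w < D j w)%N -> X i w <= X j w.
  by rewrite ltnNge; apply: contraNle => /ltW; exact: cell_homo.
rewrite s12 map_cat; apply: unimodal_cat.
- have : i0 \in s1 ++ s2 by rewrite -s12 sE mem_filter pi0 mem_enum.
  by rewrite -map_cat; case: (s1 ++ s2).
- rewrite pairwise_map.
  apply: (@sub_in_pairwise _ [pred i : 'I_n | (i < h)%N && two_phase i w]
    (relpre val ltn)).
  + move=> i j /andP[ih pi] /andP[jh pj] /= ij; apply: X_le.
    move: pi pj; rewrite /two_phase ih jh; exact: walk_accepts_lt.
  + apply/allP => i; rewrite mem_filter inE => /andP[-> ih]; rewrite andbT.
    have := map_f val ih.
    rewrite map_take val_enum_ord take_iota mem_iota /=; lia.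
  + rewrite -pairwise_map; apply: (subseq_pairwise _ vals).
    apply: map_subseq.
    exact: subseq_trans (filter_subseq _ _) (take_subseq _ _).
- rewrite pairwise_map.
  apply: (@sub_in_pairwise _ [pred i : 'I_n | (h <= i)%N && two_phase i w]
    (relpre val ltn)).
  + move=> i j /andP[hi pi] /andP[hj pj] /= ij; apply: X_le.
    move: pi pj; rewrite /two_phase !ltnNge hi hj /= => pi pj.
    have : (D' (i - h) w < D' (j - h) w)%N.
      by apply: (walk_accepts_lt _ pi pj); lia.
    by rewrite /D' !subnKC//; lia.
  + apply/allP => i; rewrite mem_filter inE => /andP[-> ih]; rewrite andbT.
    have := map_f val ih.
    rewrite map_drop val_enum_ord drop_iota mem_iota /=; lia.
  + rewrite -pairwise_map; apply: (subseq_pairwise _ vals).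
    apply: map_subseq.
    exact: subseq_trans (filter_subseq _ _) (drop_subseq _ _).
Qed.

Lemma two_phase_policy_ge w : (2 * h <= n)%N ->
  (\sum_(j < h) walk_accepts m L (D ^~ w) j +
   \sum_(j < h) walk_accepts m L (D' ^~ w) j <=
   num_selected two_phase_policy w)%N.
Proof.
move=> hn; rewrite num_selectedE.
apply: (@leq_trans (\sum_(i < n) two_phase i w)); last first.
  apply: leq_sum => i _; rewrite /accepts valK/= /two_phase_policy.
  by case: (two_phase i w).
rewrite -(big_mkord predT (fun i => two_phase i w : nat)).
rewrite (big_cat_nat (n := h))//=; last lia.
apply: leq_add.
  rewrite big_mkord; apply: leq_sum => i _.
  by rewrite /two_phase ltn_ord.
(* Acceptances from time [h + h] on are discarded. *)
rewrite (big_cat_nat (n := (h + h)%N))//=; [|lia|lia].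
apply: leq_trans (leq_addr _ _).
have -> := big_addn 0 (h + h) h predT (fun i => two_phase i w : nat).
rewrite addnK big_mkord; apply: leq_sum => i _.
by rewrite /two_phase ltnNge leq_addl/= addnK.
Qed.

End TwoPhasePolicy.

(** Here [x] is the square root of n, with n * r cells and windows of length n: each active step
    accepts with probability 1/r, and the mean travel in one half is at most n (x^2 + 1) / (4 r).
    The factor [1 + delta] in [r] leaves the margin n delta x / 2 for Chebyshev's inequality, at a
    relative cost of order [delta]. *)
Lemma threshold_estimates (R : realType) (x delta r h : R) :
    0 < delta -> delta <= 1 / 4 -> 8 <= delta ^+ 3 * x ->
    x / 2 * (1 + delta) < r -> r <= x / 2 * (1 + delta) + 1 ->
    (x ^+ 2 - 1) / 2 <= h -> h <= x ^+ 2 / 2 ->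
  [/\ 0 < r, (x ^+ 2 + 1) / (4 * r) <= r - 1 - delta * x / 2 &
      (2 - 6 * delta) * x <=
      2 * (h / r * (1 - h / (r * (delta * x / 2) ^+ 2)))].
Proof.
move=> d0 d1 dx rlo rhi hlo hhi.
have x0 : 0 < x.
  by rewrite -(pmulr_rgt0 _ (exprn_gt0 3 d0)); lra.
have d2x : 32 <= delta ^+ 2 * x.
  have : delta ^+ 3 * x <= delta ^+ 2 * x / 4.
    rewrite exprSr; have := mulr_ge0 (sqr_ge0 delta) (ltW x0); nra.
  lra.
have d1x : 128 <= delta * x.
  have : delta ^+ 2 * x <= delta * x / 4.
    by rewrite expr2; have := mulr_gt0 d0 x0; nra.
  lra.
have x512 : 512 <= x by nra.
have r0 : 0 < r by nra.
have r_ge : x / 2 <= r by nra.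
split => //.
  rewrite ler_pdivrMr ?mulr_gt0//.
  have : x / 2 * (1 + delta) * (x / 2 - 1) <= r * (r - 1 - delta * x / 2).
    by apply: ler_pM; nra.
  have : 128 * x <= delta * x * x by rewrite ler_pM2r.
  nra.
(* The left side is at most 4 / (delta^2 x), and [8 <= delta ^+ 3 * x] is calibrated to make this at
   most delta / 2. *)
have tau : h / (r * (delta * x / 2) ^+ 2) <= delta / 2.
  rewrite ler_pdivrMr ?mulr_gt0 ?exprn_gt0 ?divr_gt0 ?mulr_gt0//.
  apply: (le_trans hhi).
  have -> : delta / 2 * (r * (delta * x / 2) ^+ 2) =
      (delta ^+ 3 * x) * (r * x) / 8 by field.
  have rx : x / 2 * x <= r * x by rewrite ler_pM2r.
  have rx0 : 0 <= r * x by rewrite mulr_ge0 ?ltW.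
  have : 8 * (r * x) <= delta ^+ 3 * x * (r * x) by exact: ler_wpM2r.
  nra.
have hr : (2 - 4 * delta) * x <= 2 * (h / r).
  rewrite mulrA ler_pdivlMr//.
  apply: (@le_trans _ _ ((2 - 4 * delta) * x * (x / 2 * (1 + delta) + 1))).
    by apply: ler_wpM2l => //; nra.
  have : 128 * x <= delta * x * x by rewrite ler_pM2r.
  have : 0 <= delta ^+ 2 * x ^+ 2 by rewrite mulr_ge0 ?sqr_ge0.
  nra.
rewrite mulrA; apply: (@le_trans _ _ ((2 - 4 * delta) * x * (1 - delta))).
  by have := mulr_gt0 d0 x0; nra.
by apply: ler_pM => //; nra.
Qed.

(** * Second moment above, mean below, with explicit parameters *)

Section Asymptotics.
Context (R : realType) d (T : measurableType d) (P : probability T R).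
Variables (X : nat -> {RV P >-> R}) (F : R -> R).
Hypothesis X_indep : mutually_independent X.
Hypothesis F_cont : continuous F.
Hypothesis X_cdf : forall i x, cdf (X i) x = (F x)%:E.

Lemma Ex_sqr_num_selected_le n (a : policy T n) : (0 < n)%N -> feasible X a ->
  Ex P (fun w => (num_selected a w)%:R ^+ 2) <= 4 * n%:R + 10 * Num.sqrt n%:R.
Proof.
move=> n0 feas_a; set x : R := Num.sqrt n%:R.
have n1 : 1 <= n%:R :> R by rewrite ler1n.
have xx : x ^+ 2 = n%:R by rewrite sqr_sqrtr.
have x1 : 1 <= x by rewrite -sqrtr1 ler_sqrt.
pose s := (Num.truncn x).+1.
have xs : x < s%:R by exact: truncnS_gt.
have sx : s%:R <= x + 1.
  by rewrite -natr1 lerD2r truncn_le//; exact: le_trans x1.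
(* These choices make 2m/L equal to [s] and the bound on the mean excess divided by [L] equal to [y]
   below. Both are close to the square root of n, so the square of their sum is close to 4n. *)
pose m := (n * s)%N; pose L := (2 * n)%N.
have m0 : (0 < m)%N by rewrite /m muln_gt0 n0.
have [cell cell_homo grid] := quantile_grid X_indep F_cont X_cdf m0.
have := second_moment_le grid (L := L) (n := n) m0
  (fun i => simple_accepts i feas_a)
  (fun w => potential_feasible L cell_homo (fun i => grid_lt grid i w) feas_a).
rewrite (_ : (fun w => _) = (fun w => (num_selected a w)%:R ^+ 2)); last first.
  by apply/funext => w; rewrite num_selectedE.
set E := Ex P _ => bound.
pose y : R := (2 * n%:R + 1) / (2 * s%:R).
have s0 : 0 < s%:R :> R by rewrite ltr0n.
have nR : 0 < n%:R :> R by lra.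
have y0 : 0 <= y by rewrite divr_ge0; lra.
have yx : y <= x + 1 / 2 by rewrite ler_pdivrMr; nra.
have E_le : E <= (s%:R + y) ^+ 2 + y.
  have L2 : 0 < L%:R ^+ 2 :> R by rewrite exprn_gt0// /L natrM; nra.
  rewrite -(ler_pM2l L2) (le_trans bound)// le_eqVlt; apply/orP; left.
  apply/eqP; rewrite /y /L /m !natrM -(natr1 (2 * n)) !natrM.
  by field; rewrite !gt_eqF.
nra.
Qed.

Lemma exists_feasible_ge n (delta : R) :
    0 < delta -> delta <= 1 / 4 -> 8 <= delta ^+ 3 * Num.sqrt n%:R ->
  exists2 b : policy T n, feasible X b &
    (2 - 6 * delta) * Num.sqrt n%:R <= Ex P (fun w => (num_selected b w)%:R).
Proof.
set x : R := Num.sqrt n%:R => d0 d1 dx.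
have xx : x ^+ 2 = n%:R by rewrite sqr_sqrtr.
have n0 : (0 < n)%N.
  rewrite lt0n; apply/eqP => n_0; move: dx.
  by rewrite /x n_0 sqrtr0 mulr0; lra.
have x0 : 0 <= x by exact: sqrtr_ge0.
pose r := (Num.truncn (x / 2 * (1 + delta))).+1.
have rlo : x / 2 * (1 + delta) < r%:R by exact: truncnS_gt.
have rhi : r%:R <= x / 2 * (1 + delta) + 1.
  rewrite /r -natr1 lerD2r truncn_le.
  by rewrite mulr_ge0 ?divr_ge0//; lra.
pose h := n./2.
have hn : (2 * h <= n)%N by have := odd_double_half n; rewrite -/h; lia.
have hhi : h%:R <= x ^+ 2 / 2.
  by rewrite xx ler_pdivlMr// -natrM ler_nat mulnC.
have hlo : (x ^+ 2 - 1) / 2 <= h%:R.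
  rewrite xx ler_pdivrMr// lerBlDr -natrM natr1 ler_nat.
  by have := odd_double_half n; rewrite -/h; case: odd; lia.
have [r0 small large] := threshold_estimates d0 d1 dx rlo rhi hlo hhi.
have nR : 0 < n%:R :> R by rewrite ltr0n.
pose m := (n * r)%N.
have m0 : (0 < m)%N by rewrite muln_gt0 n0.
have nm : (n <= m)%N by rewrite leq_pmulr.
have [cell cell_homo grid] := quantile_grid X_indep F_cont X_cdf m0.
have grid' := uniform_grid_rev (uniform_grid_shift grid h).
exists (two_phase_policy (n := n) X cell m n h).
  exact: two_phase_policy_feasible.
(* The margin of [threshold_estimates], multiplied by n to be counted in cells. *)
pose t : R := n%:R * (delta * x / 2).
have x_gt0 : 0 < x by rewrite sqrtr_gt0.
have t0 : 0 < t by rewrite !mulr_gt0.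
have tK : t <= m%:R - n%:R - h%:R * ((n * n.+1)%:R / (2 * m)%:R).
  have -> : h%:R * ((n * n.+1)%:R / (2 * m)%:R) =
      n%:R * (h%:R * 2 / n%:R * ((x ^+ 2 + 1) / (4 * r%:R))) :> R.
    rewrite xx /m !natrM -natr1; field.
    by rewrite !gt_eqF.
  rewrite /m natrM /t -[X in _ - X - _]mulr1 -!mulrBr ler_pM2l//.
  have hn1 : h%:R * 2 / n%:R <= 1 :> R.
    by rewrite ler_pdivrMr// mul1r -natrM ler_nat mulnC.
  have : h%:R * 2 / n%:R * ((x ^+ 2 + 1) / (4 * r%:R)) <=
      (x ^+ 2 + 1) / (4 * r%:R).
    apply: ler_piMl => //.
    by rewrite divr_ge0 ?addr_ge0 ?sqr_ge0 ?mulr_ge0// ltW.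
  lra.
have bound : h%:R * (n%:R / m%:R) * (1 - h%:R * (n%:R ^+ 3 / m%:R) / t ^+ 2) =
    h%:R / r%:R * (1 - h%:R / (r%:R * (delta * x / 2) ^+ 2)) :> R.
  rewrite /m /t natrM; field.
  by rewrite !gt_eqF.
have W1 := Ex_walk_accepts_ge grid nm m0 t0 tK.
have W2 := Ex_walk_accepts_ge grid' nm m0 t0 tK.
rewrite bound in W1; rewrite bound in W2.
set N1 := (X in _ <= Ex P X) in W1; set N2 := (X in _ <= Ex P X) in W2.
have simple_N (G : nat -> set (set T)) D : uniform_grid P G m D ->
    simple (fun w => (\sum_(j < h) walk_accepts m n (D ^~ w) j)%:R : R).
  move=> gridD; apply: (simple_comp (fun k => k%:R : R)).
  apply: (@simple_sum _ _ nat) => j; apply: (simple_comp nat_of_bool).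
  by apply: (simple_grid gridD (i := j.+1)); exact: (simple_walk_accepts gridD).
have sN1 : simple N1 by exact: simple_N grid.
have sN2 : simple N2 by exact: simple_N grid'.
apply: (@le_trans _ _ (Ex P (fun w => N1 w + N2 w))).
  rewrite ExD//; lra.
apply: Ex_le.
- exact: simple_comp2.
- apply: (simple_comp (fun k => k%:R : R)); apply: simple_num_selected.
  exact: two_phase_policy_feasible.
- move=> w; rewrite /N1 /N2 -natrD ler_nat.
  by have := two_phase_policy_ge X cell m n w hn.
Qed.

End Asymptotics.

(** * Convergence in probability by Chebyshev's inequality *)

Theorem corollary1 (R : realType) (d : measure_display)
    (T : measurableType d) (P : probability T R) (X : nat -> {RV P >-> R})
    (F : R -> R)
    (X_indep : mutually_independent X)
    (F_cont : continuous F)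
    (X_cdf : forall (i : nat) (x : R), cdf (X i) x = (F x)%:E)
    (pi : forall n : nat, policy T n)
    (pi_opt : forall n : nat, (1 <= n)%N -> optimal X (pi n)) :
  cvg_in_probability P
    (fun n w => (num_selected (pi n) w)%:R / Num.sqrt n%:R) 2.
Proof.
move=> eps eps0.
pose bad n := [set w | eps < `|(num_selected (pi n) w)%:R / Num.sqrt n%:R - 2|].
have simple_U n : (0 < n)%N -> simple (num_selected (pi n)).
  by move=> n0; have [feas _] := pi_opt n n0; exact: simple_num_selected feas.
have simple_f n (f : nat -> R) : (0 < n)%N ->
    simple (fun w => f (num_selected (pi n) w)).
  by move=> n0; exact: (simple_comp f (simple_U n n0)).
have mbad n : (0 < n)%N -> measurable (bad n).
  move=> n0.
  exact: ((simple_U n n0).2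
    [set k : nat | eps < `|k%:R / Num.sqrt n%:R - 2|]).
(* The mean square deviation from 2 is at most (4 + 10/x) - 4 (2 - 6 delta) + 4, which is at most 26
   delta. *)
have bad_le (delta : R) n : 0 < delta -> delta <= 1 / 4 ->
    8 <= delta ^+ 3 * Num.sqrt n%:R ->
    (P (bad n) <= (26 * delta / eps ^+ 2)%:E)%E.
  move=> d0 d1; set x : R := Num.sqrt n%:R => dx.
  have x0 : 0 < x.
    by rewrite -(pmulr_rgt0 _ (exprn_gt0 3 d0)); lra.
  have n0 : (0 < n)%N by rewrite -(ltr0n R) -sqrtr_gt0.
  have xx : x ^+ 2 = n%:R by rewrite sqr_sqrtr.
  have [feas opt] := pi_opt n n0.
  have [b feas_b b_ge] := exists_feasible_ge X_indep F_cont X_cdf d0 d1 dx.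
  have U2 := Ex_sqr_num_selected_le X_indep F_cont X_cdf n0 feas.
  (* Optimality transfers the lower bound from the explicit policy [b] to [pi n]. *)
  have U1 : (2 - 6 * delta) * x <= Ex P (fun w => (num_selected (pi n) w)%:R).
    apply: (le_trans b_ge); rewrite -lee_fin -!ExE.
    - rewrite -[leRHS]/(expected_selected P (pi n)) opt.
      by apply: ereal_sup_ubound; exists b.
    - exact: (simple_f n (fun k => k%:R)).
    - by exact: (simple_comp (fun k => k%:R : R) (simple_num_selected feas_b)).
  rewrite Ex_indic ?lee_fin; last exact: mbad.
  apply: (@le_trans _ _ (Ex P (fun w => (eps ^+ 2)^-1 *
      ((num_selected (pi n) w)%:R / x - 2) ^+ 2))).
    apply: Ex_le.
    - exact/simple_indic/mbad.
    - exact: (simple_f n (fun k => (eps ^+ 2)^-1 * (k%:R / x - 2) ^+ 2)).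
    - move=> w; rewrite indicE; case: (boolP (w \in bad n)) => [|_]; last first.
        by rewrite mulr_ge0 ?invr_ge0 ?sqr_ge0.
      rewrite inE /bad/= -/x => big.
      rewrite mulrC ler_pdivlMr ?exprn_gt0// mul1r.
      rewrite -(real_normK (num_real (_ - 2))).
      by rewrite ler_pXn2r ?nnegrE//; exact: ltW.
  rewrite ExZ; last exact: (simple_f n (fun k => (k%:R / x - 2) ^+ 2)).
  rewrite mulrC ler_pM2r ?invr_gt0 ?exprn_gt0//.
  have -> : (fun w => ((num_selected (pi n) w)%:R / x - 2) ^+ 2) = (fun w =>
      (x ^+ 2)^-1 * (num_selected (pi n) w)%:R ^+ 2 +
      (- (4 / x) * (num_selected (pi n) w)%:R + 4)) :> (T -> R).
    by apply/funext => w; field; rewrite gt_eqF.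
  rewrite ExD; last 2 first.
  - exact: (simple_f n (fun k => (x ^+ 2)^-1 * k%:R ^+ 2)).
  - exact: (simple_f n (fun k => - (4 / x) * k%:R + 4)).
  rewrite ExD; last 2 first.
  - exact: (simple_f n (fun k => - (4 / x) * k%:R)).
  - exact: simple_cst.
  rewrite Ex_cst ExZ; last exact: (simple_f n (fun k => k%:R ^+ 2)).
  rewrite ExZ; last exact: (simple_f n (fun k => k%:R)).
  have A : (x ^+ 2)^-1 * Ex P (fun w => (num_selected (pi n) w)%:R ^+ 2) <=
      4 + 10 / x.
    rewrite mulrC ler_pdivrMr ?exprn_gt0//.
    rewrite (_ : (4 + 10 / x) * x ^+ 2 = 4 * n%:R + 10 * x)//.
    by rewrite -xx; field; rewrite gt_eqF.
  have B : (2 - 6 * delta) * 4 <=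
      4 / x * Ex P (fun w => (num_selected (pi n) w)%:R).
    rewrite mulrAC ler_pdivlMr// mulrAC [leRHS]mulrC ler_pM2r//.
  (* From [8 <= delta ^+ 3 * x] and [delta <= 1 / 4] follows delta x >= 128, more than enough. *)
  have C : 10 / x <= 2 * delta.
    rewrite ler_pdivrMr//.
    have : delta ^+ 3 * x <= delta * x / 16.
      have : delta ^+ 2 <= 1 / 16 by nra.
      by rewrite exprSr -mulrA; have := mulr_gt0 d0 x0; nra.
    lra.
  lra.
apply/fine_cvgP; split.
  exists 1%N => // n /= n1; rewrite fin_num_measure//; exact: mbad.
apply/cvgrPdist_le => e e0.
(* The second term brings 26 delta / eps^2 below [e]; the first is the cap required by [bad_le]. *)
pose delta := Num.min (1 / 4) (e * eps ^+ 2 / 26).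
have d0 : 0 < delta by rewrite lt_min !divr_gt0 ?mulr_gt0 ?exprn_gt0.
have d1 : delta <= 1 / 4 by rewrite ge_min lexx.
have d2 : 26 * delta / eps ^+ 2 <= e.
  rewrite ler_pdivrMr ?exprn_gt0// mulrC -ler_pdivlMr//.
  by rewrite ge_min lexx orbT.
(* Beyond this index the square root of n exceeds 8 / delta^3. *)
exists (Num.truncn ((8 / delta ^+ 3) ^+ 2)).+1 => // n /= Nn.
have dx : 8 <= delta ^+ 3 * Num.sqrt n%:R.
  rewrite mulrC -ler_pdivrMr ?exprn_gt0//.
  rewrite -[leLHS]ger0_norm ?divr_ge0 ?exprn_ge0 ?(ltW d0)//.
  rewrite -sqrtr_sqr ler_sqrt//; apply: ltW.
  by apply: lt_le_trans (truncnS_gt _) _; rewrite ler_nat.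
have n0 : (0 < n)%N by lia.
rewrite sub0r normrN ger0_norm; last by rewrite fine_ge0.
have mb := mbad n n0.
rewrite -lee_fin fineK ?fin_num_measure//.
by apply: le_trans (bad_le _ _ d0 d1 dx) _; rewrite lee_fin.
Qed.
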